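(* Let $S$ be an idempotent semifield and let $n$ be a positive integer. Let $UT_n(S^* )$ be the semigroup of upper triangular $n\times n$ matrices over $S$ all of whose entries on and above the diagonal are non-zero, and let $U_n(S^* )$ be the subsemigroup of those matrices in $UT_n(S^* )$ with all diagonal entries equal to $\mathbf{1}$. Then $U_n(S^* )$ is the idempotent generated subsemigroup of $UT_n(S^* )$ (that is, the subsemigroup generated by all idempotents of $UT_n(S^* )$). Every element of $U_n(S^* )$ can be written as a product of at most $n-1$ idempotent elements.
   Context: A semiring is a commutative monoid $(S,+,\mathbf{0})$ with an associative multiplication distributing over addition on both sides, for which $\mathbf{0}$ is absorbing; semirings here are commutative and have a multiplicative identity $\mathbf{1}$. An idempotent semifield is such a semiring $S$ with $x+x=x$ for all $x\in S$, in which $S^*=S\setminus\{\mathbf{0}\}$ is an abelian group under multiplication. An upper triangular matrix is one whose entries below the main diagonal are all $\mathbf{0}$. Matrices are multiplied in the usual way using the operations of $S$. *)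

(* Defs.v *)
From HB Require Import structures.
From mathcomp Require Import all_boot all_order all_algebra.
Set Implicit Arguments.
Unset Strict Implicit.
Unset Printing Implicit Defensive.
Import GRing.Theory.
Local Open Scope ring_scope.

(* The last three clauses say that S^* = S \ {0} is a group under the product
   of S; associativity and commutativity come from comPzSemiRingType. *)
Definition idempotent_semifield (S : comPzSemiRingType) : Prop :=
  [/\ forall x : S, x + x = x,
      forall x y : S, x != 0 -> y != 0 -> x * y != 0,
      (1 : S) != 0
    & forall x : S, x != 0 -> exists2 y : S, y != 0 & x * y = 1].

Definition upper_triangular (S : comPzSemiRingType) (n : nat) (A : 'M[S]_n) :
    Prop :=
  forall i j : 'I_n, (j < i)%N -> A i j = 0.

Definition UT (S : comPzSemiRingType) (n : nat) (A : 'M[S]_n) : Prop :=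
  upper_triangular A /\ (forall i j : 'I_n, (i <= j)%N -> A i j != 0).

Definition U (S : comPzSemiRingType) (n : nat) (A : 'M[S]_n) : Prop :=
  UT A /\ (forall i : 'I_n, A i i = 1).

Definition UT_idempotent (S : comPzSemiRingType) (n : nat) (A : 'M[S]_n) :
    Prop :=
  UT A /\ A *m A = A.

(* As UT is closed under products (UT_mulmx below), the subsemigroup generated
   by a subset of UT is the same computed in UT or in the semigroup of all
   matrices. *)
Inductive generated_subsemigroup (S : comPzSemiRingType) (n : nat)
    (X : 'M[S]_n -> Prop) : 'M[S]_n -> Prop :=
| gen_incl (A : 'M[S]_n) : X A -> generated_subsemigroup X A
| gen_mul (A B : 'M[S]_n) : generated_subsemigroup X A ->
    generated_subsemigroup X B -> generated_subsemigroup X (A *m B).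

(* The empty product is the identity matrix.  That matrix lies in U only for
   n <= 1, so a product in U is a product of at least one factor when n >= 2;
   for n = 1 the only element of U is the empty product. *)
Definition mxprod (S : comPzSemiRingType) (n : nat) (s : seq 'M[S]_n) :
    'M[S]_n :=
  \big[mulmx/1%:M]_(A <- s) A.

Lemma UT_mulmx (S : comPzSemiRingType) (n : nat) (A B : 'M[S]_n) :
  idempotent_semifield S -> UT A -> UT B -> UT (A *m B).
Proof.
case=> addxx mul_neq0 _ _ [upA nzA] [upB nzB]; split=> i j lij; rewrite mxE.
  rewrite big1 // => k _; have [lki|lik] := ltnP k i.
    by rewrite upA ?mul0r.
  by rewrite [B k j]upB ?mulr0 ?(leq_trans lij).
rewrite (bigD1 i) //=; set x := A i i * B i j; set y := (\sum_(_ | _) _).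
have: x != 0 by rewrite mul_neq0 ?nzA ?nzB.
by apply: contra_neq => xy0; rewrite -[x]addr0 -xy0 addrA addxx.
Qed.

Lemma U_mulmx (S : comPzSemiRingType) (n : nat) (A B : 'M[S]_n) :
  idempotent_semifield S -> U A -> U B -> U (A *m B).
Proof.
move=> hS [utA dA] [utB dB]; split; first exact: UT_mulmx.
move=> i; rewrite mxE (bigD1 i) //= dA dB mulr1 big1 ?addr0 // => k neq_ki.
have [lki|lik] := ltnP k i; first by rewrite utA.1 ?mul0r.
rewrite [B k i]utB.1 ?mulr0 // ltn_neqAle lik andbT.
by rewrite eq_sym; exact: neq_ki.
Qed.

(* Main.v *)
Require Import Defs.
From HB Require Import structures.
From mathcomp Require Import all_boot all_order all_algebra.
Local Open Scope ring_scope.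

(** An idempotent semifield carries the order [x <= y] iff [x + y = y], for
    which sums are suprema, multiplication is monotone and, thanks to inverses,
    any two non-zero elements have a non-zero lower bound.  A matrix of [UT]
    that is idempotent has idempotent, hence trivial, diagonal entries; as [U]
    is closed under products, the generated subsemigroup lies in [U].

    For the factorisation of [A] in [U], suppose first that zeros were allowed
    above the diagonal.  Let [N_k] be the [k]-th row of [A] off the diagonal.
    Then [1 + N_k] is idempotent, and since [N_k N_l = 0] for [l <= k], the
    product of the [1 + N_k] in decreasing order of [k] is [1 + \sum_k N_k = A].
    The last row contributes nothing, which leaves [n - 1] factors.

    As zeros are not allowed, they are replaced by elements [d j], depending
    only on the column, so small that every spurious term they create is
    absorbed.  Two conditions suffice: [A i l * d j <= A i j] for [i <= l <= j] and
    [d l * A l j <= d j] for [l < j].  So [d] must be tiny compared with all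
    entries and grow quickly with [j]: high powers of a small [t], with
    exponent decreasing in [j], will do ([exists_filler]).  Writing [keep_rows T]
    for the matrix that keeps the rows of [A] in [T] and is filled with [d]
    elsewhere, one absorption lemma, [keep_rows_mul], yields both that
    single-row matrices are idempotent and that they multiply as above. *)

Set Implicit Arguments.
Unset Strict Implicit.
Unset Printing Implicit Defensive.
Import GRing.Theory.

(** * The natural order of an idempotent semifield *)

Definition nle (S : comPzSemiRingType) (x y : S) : Prop := x + y = y.

Local Notation "x <=+ y" := (nle x y) (at level 70, no associativity).

Section Order.

Context (S : comPzSemiRingType) (hS : idempotent_semifield S).
Implicit Types x y z : S.

Lemma nle_refl x : x <=+ x.
Proof. by case: hS => addxx _ _ _; apply: addxx. Qed.

Lemma nle0 x : 0 <=+ x.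
Proof. exact: add0r. Qed.

Lemma nle_trans y x z : x <=+ y -> y <=+ z -> x <=+ z.
Proof. by rewrite /nle => xy yz; rewrite -yz addrA xy. Qed.

Lemma nle_anti x y : x <=+ y -> y <=+ x -> x = y.
Proof. by rewrite /nle => xy yx; rewrite -yx addrC. Qed.

Lemma nle_addl x y : x <=+ x + y.
Proof. by rewrite /nle addrA nle_refl. Qed.

Lemma nle_mul2l z x y : x <=+ y -> z * x <=+ z * y.
Proof. by rewrite /nle => xy; rewrite -mulrDr xy. Qed.

Lemma nle_mul x y x' y' : x <=+ y -> x' <=+ y' -> x * x' <=+ y * y'.
Proof.
move=> xy xy'; apply: (nle_trans (nle_mul2l x xy')).
by rewrite ![_ * y']mulrC; apply: nle_mul2l.
Qed.

Lemma nle_exp1 x k : x <=+ 1 -> x ^+ k <=+ 1.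
Proof.
move=> x1; elim: k => [|k IHk]; first by rewrite expr0; apply: nle_refl.
by rewrite exprS -[1]mulr1; apply: nle_mul.
Qed.

Lemma sum_nle (I : finType) (F : I -> S) y :
  (forall i, F i <=+ y) -> \sum_i F i <=+ y.
Proof.
move=> Fy; elim/big_ind: _ => [|a b ay by_|i _]; [exact: nle0| |exact: Fy].
by rewrite /nle -addrA by_ ay.
Qed.

Lemma nle_sum (I : finType) (F : I -> S) i : F i <=+ \sum_j F j.
Proof. by rewrite (bigD1 i) //=; apply: nle_addl. Qed.

Lemma addr_neq0 x y : x != 0 -> x + y != 0.
Proof. by apply: contra_neq => xy0; rewrite -[x]addr0 -xy0; apply: nle_addl. Qed.

Lemma expr_neq0 x k : x != 0 -> x ^+ k != 0.
Proof.
case: hS => _ mul_neq0 nz1 _ nzx.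
by elim: k => [|k IHk]; rewrite ?expr0 ?exprS ?mul_neq0.
Qed.

(** Inversion reverses the order, so the inverse of [x^-1 + y^-1] is the meet of
    [x] and [y]; it equals [x * y / (x + y)]. *)
Lemma exists_lower_bound x y : x != 0 -> y != 0 ->
  exists z, [/\ z != 0, z <=+ x & z <=+ y].
Proof.
case: hS => _ mul_neq0 _ inv nzx nzy.
have [w nzw xyw1] := inv _ (addr_neq0 y nzx).
exists (x * y * w); split; first by rewrite !mul_neq0.
  rewrite -[X in _ <=+ X]mulr1 -mulrA; apply: nle_mul2l.
  by rewrite -xyw1 mulrDl addrC; apply: nle_addl.
rewrite -[X in _ <=+ X]mulr1 [x * y]mulrC -mulrA; apply: nle_mul2l.
by rewrite -xyw1 mulrDl; apply: nle_addl.
Qed.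

(** The condition [t * x <= 1] says that [t] is also below the inverse of [x]. *)
Lemma exists_small (s : seq S) : (forall x, x \in s -> x != 0) ->
  exists2 t, t != 0 & forall x, x \in s -> t <=+ x /\ t * x <=+ 1.
Proof.
case: hS => _ _ nz1 inv.
elim: s => [|x s IHs] nzs; first by exists 1.
have nzx : x != 0 by apply: nzs; rewrite mem_head.
have [|t nzt tP] := IHs; first by move=> z zs; apply: nzs; rewrite inE zs orbT.
have [y nzy xy1] := inv x nzx.
have [u [nzu ux uy]] := exists_lower_bound nzx nzy.
have [v [nzv vt vu]] := exists_lower_bound nzt nzu.
exists v => // z; rewrite inE => /predU1P[-> | /tP[tz tz1]]; last first.
  split; first exact: nle_trans tz.
  by apply: nle_trans tz1; apply: nle_mul => //; apply: nle_refl.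
split; first exact: nle_trans ux.
by rewrite -xy1 mulrC; apply/nle_mul2l/(nle_trans vu).
Qed.

End Order.

(** * Idempotents are unitriangular *)

Lemma UT_idempotent_U (S : comPzSemiRingType) n (E : 'M[S]_n) :
  idempotent_semifield S -> UT_idempotent E -> U E.
Proof.
case=> _ _ _ inv [utE EE]; split=> // i.
have [y _ Ey1] := inv _ (utE.2 i i (leqnn i)).
have: (E *m E) i i = E i i by rewrite EE.
rewrite mxE (bigD1 i) //= big1 => [|k neq_ki]; last first.
  have [lki|lik] := ltnP k i; first by rewrite utE.1 ?mul0r.
  rewrite [E k i]utE.1 ?mulr0 // ltn_neqAle lik andbT.
  by rewrite eq_sym; apply: neq_ki.
by rewrite addr0 => /(congr1 (fun x => x * y)); rewrite -mulrA Ey1 mulr1.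
Qed.

Lemma generated_U (S : comPzSemiRingType) n (A : 'M[S]_n) :
  idempotent_semifield S ->
  generated_subsemigroup (@UT_idempotent S n) A -> U A.
Proof.
move=> hS; elim=> [E | B C _ UB _ UC]; first exact: UT_idempotent_U.
exact: U_mulmx.
Qed.

(** * Absorbing fillers *)

(** The exponent of [t] is at least 2, one factor to cancel [A i l] and one to
    get below [A i j]; it drops by at least 1 from [l] to [j], which cancels
    [A l j]. *)
Lemma exists_filler (S : comPzSemiRingType) n (A : 'M[S]_n) :
  idempotent_semifield S -> U A ->
  exists d : 'I_n -> S,
    [/\ forall j, d j != 0,
        forall i l j : 'I_n, (i <= l <= j)%N -> A i l * d j <=+ A i j
      & forall l j : 'I_n, (l < j)%N -> d l * A l j <=+ d j].
Proof.
move=> hS [[upA nzA] dA].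
pose s := [seq A p.1 p.2 | p in [pred p : 'I_n * 'I_n | p.1 <= p.2]%N].
have [|t nzt ts] := @exists_small S hS s.
  by move=> x /imageP[[i j] /= leij ->]; apply: nzA.
have tP (i j : 'I_n) : (i <= j)%N -> t <=+ A i j /\ t * A i j <=+ 1.
  by move=> leij; apply/ts/imageP; exists (i, j).
exists (fun j => t ^+ (n - j).+1); split.
- by move=> j; apply: expr_neq0.
- move=> i l j /andP[leil lelj].
  have t1 : t <=+ 1 by rewrite -(dA j); apply: (tP j j _).1.
  rewrite -[(n - j)%N]prednK ?subn_gt0 // 2!exprS mulrA [A i l * t]mulrC.
  rewrite -[A i j]mulr1 -[A i j * 1]mul1r.
  apply: nle_mul => //; first exact: (tP i l leil).2.
  apply: nle_mul => //; last exact: (nle_exp1 hS).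
  exact: (tP i j (leq_trans leil lelj)).1.
move=> l j ltlj.
have t1 : t <=+ 1 by rewrite -(dA j); apply: (tP j j _).1.
have -> : (n - l).+1 = ((n - j).+1 + (j - l.+1).+1)%N.
  by rewrite addSn subnSK // addnBA 1?ltnW // subnK // ltnW.
rewrite exprD [t ^+ (j - l.+1).+1]exprSr -2!mulrA -[X in _ <=+ X]mulr1; apply: nle_mul2l.
rewrite -[1]mulr1; apply: nle_mul => //; first exact: (nle_exp1 hS).
exact: (tP l j (ltnW ltlj)).2.
Qed.

(** * Factorisation into single-row idempotents *)

Definition keep_rows (S : comPzSemiRingType) n (A : 'M[S]_n) (d : 'I_n -> S)
    (T : pred nat) : 'M[S]_n :=
  \matrix_(i, j) if (j <= i)%N || T i then A i j else d j.

Section KeepRows.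

Context (S : comPzSemiRingType) (hS : idempotent_semifield S) (n : nat).
Context (A : 'M[S]_n) (UA : U A) (d : 'I_n -> S) (nzd : forall j, d j != 0).
Context (Ad : forall i l j : 'I_n, (i <= l <= j)%N -> A i l * d j <=+ A i j).
Context (dA : forall l j : 'I_n, (l < j)%N -> d l * A l j <=+ d j).

Local Notation G := (keep_rows A d).

Lemma UT_keep_rows T : UT (G T).
Proof.
case: UA => [[upA nzA] _]; split=> i j leij; rewrite mxE.
  by rewrite ltnW //= upA.
by case: ifP => // _; apply: nzA.
Qed.

Lemma keep_rows_diag T i : G T i i = 1.
Proof. by rewrite mxE leqnn UA.2. Qed.

(* The case [l = i] of [Ad]. *)
Lemma filler_le (i j : 'I_n) : (i <= j)%N -> d j <=+ A i j.
Proof. by move=> leij; rewrite -[d j]mul1r -(UA.2 i); apply: Ad; rewrite leqnn. Qed.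

Lemma filler_le_keep_rows T (i j : 'I_n) : (i <= j)%N -> d j <=+ G T i j.
Proof.
by move=> leij; rewrite mxE; case: ifP => _; [apply: filler_le|apply: nle_refl].
Qed.

Lemma keep_rows_mono (T T' : pred nat) (i j : 'I_n) :
  (forall k, T k -> T' k) -> (i <= j)%N -> G T i j <=+ G T' i j.
Proof.
move=> TT' leij; rewrite [G T i j]mxE; case: ifP => [kept|_].
  rewrite mxE; suff -> : (j <= i)%N || T' i by apply: nle_refl.
  by case/orP: kept => [->|/TT'->]; rewrite ?orbT.
exact: filler_le_keep_rows.
Qed.

(** The hypothesis excludes the products [A i l * A l j] with [i < l < j],
    the only ones that need not be absorbed. *)
Lemma keep_rows_mul (T T' : pred nat) :
  (forall i l, T i -> T' l -> (l <= i)%N) ->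
  G T *m G T' = G (predU T T').
Proof.
move=> TT'; apply/matrixP => i j.
have [ltji|leij] := ltnP j i.
  have := UT_mulmx hS (UT_keep_rows T) (UT_keep_rows T').
  by case=> -> // _; rewrite (UT_keep_rows _).1.
rewrite mxE; apply: nle_anti.
  apply: sum_nle => l.
  have [ltli|leil] := ltnP l i.
    by rewrite (UT_keep_rows T).1 // mul0r; apply: nle0.
  have [ltjl|lelj] := ltnP j l.
    by rewrite (UT_keep_rows T').1 // mulr0; apply: nle0.
  have [<-|neq_il] := eqVneq i l.
    rewrite keep_rows_diag mul1r; apply: keep_rows_mono => // k /= ->.
    exact: orbT.
  have [->|neq_lj] := eqVneq l j.
    by rewrite keep_rows_diag mulr1; apply: keep_rows_mono => // k /= ->.
  have ltil : (i < l)%N by rewrite ltn_neqAle neq_il.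
  have ltlj : (l < j)%N by rewrite ltn_neqAle neq_lj.
  rewrite [G T i l]mxE leqNgt ltil /=; case: ifP => Ti.
    rewrite !mxE /= Ti orbT leqNgt ltlj /=.
    have /negbTE-> : ~~ T' l.
      by apply/negP => /(TT' _ _ Ti); rewrite leqNgt ltil.
    by apply: Ad; rewrite leil.
  apply: (nle_trans _ (filler_le_keep_rows _ leij)).
  apply: (nle_trans _ (dA ltlj)); apply: nle_mul2l.
  by rewrite mxE; case: ifP => _; [apply: nle_refl|apply: filler_le].
(* The entry is attained at [l = j] if row [i] is kept on the left, and at
   [l = i] otherwise. *)
have [Ti|nTi] := boolP (T i).
  have -> : G (predU T T') i j = G T i j * G T' j j.
    by rewrite keep_rows_diag mulr1 !mxE /= Ti.
  exact: (@nle_sum _ hS _ (fun l => G T i l * G T' l j)).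
have -> : G (predU T T') i j = G T i i * G T' i j.
  by rewrite keep_rows_diag mul1r !mxE /= (negbTE nTi).
exact: (@nle_sum _ hS _ (fun l => G T i l * G T' l j)).
Qed.

Lemma eq_keep_rows (T T' : pred nat) : T =1 T' -> G T = G T'.
Proof. by move=> eqT; apply/matrixP => i j; rewrite !mxE eqT. Qed.

Lemma keep_row_idempotent k : UT_idempotent (G (pred1 k)).
Proof.
split; first exact: UT_keep_rows.
rewrite keep_rows_mul => [|i l /eqP-> /eqP->] //.
by apply: eq_keep_rows => i /=; rewrite orbb.
Qed.

(** Rows are multiplied in decreasing order, as [keep_rows_mul] requires.  The
    empty product is the identity, which is not filled with [d]; hence at least
    one factor. *)
Lemma mxprod_keep_row m :
  mxprod [seq G (pred1 k) | k <- rev (iota 0 m.+1)] = G (fun i => i < m.+1)%N.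
Proof.
elim: m => [|m IHm].
  by rewrite /mxprod big_cons big_nil mulmx1; apply: eq_keep_rows => -[].
rewrite -[m.+2]addn1 iotaD rev_cat map_cat /= /mxprod big_cons -/(mxprod _).
rewrite IHm add0n keep_rows_mul => [|i l /eqP-> /ltnW //].
by apply: eq_keep_rows => i /=; rewrite addn1 [RHS]ltnS [RHS]leq_eqVlt.
Qed.

Lemma keep_rows_all : G (fun i => i < n - 1)%N = A.
Proof.
apply/matrixP => i j; rewrite mxE; case: ifP => // /negbT.
rewrite negb_or -ltnNge => /andP[ltij].
by rewrite ltn_subRL add1n (leq_ltn_trans ltij).
Qed.

End KeepRows.

Lemma U_factorisation (S : comPzSemiRingType) n (A : 'M[S]_n) :
  idempotent_semifield S -> U A ->
  exists s : seq 'M[S]_n,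
    [/\ (size s <= n - 1)%N,
        (forall E : 'M[S]_n, E \in s -> UT_idempotent E)
      & A = mxprod s].
Proof.
move=> hS UA; have [d [nzd Ad dA]] := exists_filler hS UA.
have [n1|n1] := posnP (n - 1).
  exists [::]; split=> //; rewrite /mxprod big_nil; apply/matrixP => i j.
  have eq0 (k : 'I_n) : k = 0%N :> nat.
    by apply/eqP; rewrite -leqn0 -n1 leq_subRL ?add1n // (leq_ltn_trans _ (ltn_ord k)).
  have -> : i = j by apply: val_inj; rewrite /= !eq0.
  by rewrite mxE eqxx UA.2.
exists [seq keep_rows A d (pred1 k) | k <- rev (iota 0 (n - 1))]; split.
- by rewrite size_map size_rev size_iota.
- by move=> E /mapP[k _ ->]; apply: keep_row_idempotent.
by rewrite -(prednK n1) mxprod_keep_row // prednK // keep_rows_all.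
Qed.

Lemma generated_mxprod (S : comPzSemiRingType) n (X : 'M[S]_n -> Prop)
    (E : 'M[S]_n) (s : seq 'M[S]_n) :
  (forall B, B \in E :: s -> X B) -> generated_subsemigroup X (mxprod (E :: s)).
Proof.
rewrite /mxprod; elim: s E => [|F s IHs] E XEs.
  by rewrite big_cons big_nil mulmx1; apply/gen_incl/XEs/mem_head.
rewrite big_cons; apply: gen_mul; first exact/gen_incl/XEs/mem_head.
by apply: IHs => B Bs; apply: XEs; rewrite inE Bs orbT.
Qed.

Theorem corollary4p23 (S : comPzSemiRingType) (hS : idempotent_semifield S)
    (n : nat) (hn : (0 < n)%N) :
  (forall A : 'M[S]_n,
     U A <-> generated_subsemigroup (@UT_idempotent S n) A) /\
  (forall A : 'M[S]_n, U A ->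
     exists s : seq 'M[S]_n,
       [/\ (size s <= n - 1)%N,
           (forall E : 'M[S]_n, E \in s -> UT_idempotent E)
         & A = mxprod s]).
Proof.
split=> A; last exact: U_factorisation.
split=> [UA|]; last exact: generated_U.
have [[|E s] [_ idemp defA]] := U_factorisation hS UA; last first.
  by rewrite defA; apply: generated_mxprod.
(* An empty product is the identity matrix, an idempotent of [UT] since it is
   [A]. *)
apply: gen_incl; split; first exact: UA.1.
by rewrite defA /mxprod big_nil mulmx1.
Qed.
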